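(* \begin{equation*} \Gamma_{i}^{\left[\substack{s\\ s}\right]\times i} = \begin{cases} 2^{2s+2i-2} - 3\cdot 2^{3i-4} + 2^{2i-3} & \text{if } 1\leq i\leq s,\\ 2^{2s+2i-2} - 3\cdot 2^{3i-4} + 2^{4i-2s-5} & \text{if } s+1\leq i\leq 2s. \end{cases} \end{equation*}
   Context: $\Gamma_{i}^{\left[\substack{s\\ s}\right]\times k}$ denotes the number of rank $i$ matrices over $\mathbb{F}_2$ of the form $\left[\frac{A}{B}\right]$ where $A$ and $B$ are both $s\times k$ persymmetric matrices over $\mathbb{F}_2$; here $k=i$. *)

(* Defs.v *)
From HB Require Import structures.
From mathcomp Require Export all_boot all_order all_algebra.

Set Implicit Arguments.
Unset Strict Implicit.
Unset Printing Implicit Defensive.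

Import GRing.Theory.
Local Open Scope ring_scope.

(* Not symmetry about the anti-diagonal of a square matrix: entries are constant
   along each anti-diagonal (a possibly rectangular Hankel matrix). *)
Definition persymmetric (s k : nat) (A : 'M['F_2]_(s, k)) : bool :=
  [forall i : 'I_s, forall j : 'I_k, forall i' : 'I_s, forall j' : 'I_k,
    (i + j == i' + j')%N ==> (A i j == A i' j')].

Definition Gamma (s k i : nat) : nat :=
  #|[set M : 'M['F_2]_(s + s, k) |
      [exists A : 'M['F_2]_(s, k), exists B : 'M['F_2]_(s, k),
        [&& persymmetric A, persymmetric B & M == col_mx A B]]
      && (\rank M == i)]|.

(* Main.v *)
(** A pair of [s x k] persymmetric matrices is a pair of linear forms [a], [b]
    on polynomials of degree [< s + k - 1], and the kernel of the stacked matrix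
    is the space [K] of polynomials [v] of degree [< k] with
    [a (v X^j) = b (v X^j) = 0] for [j < s].  Let [K'] be the analogous space for
    [(k - 1, s + 1)] and the same forms, and put [x = #|K|], [y = #|K'|].  Then
    [K'] is the kernel of [v |-> (v_(k-1), a (v X^s), b (v X^s))] on [K].  On a
    nonzero [K] this map is not zero (otherwise [K] would be stable under
    multiplication by [X]) and, when [k <= 2 s], not onto (otherwise the nonzero
    left kernel would be).  Hence [x] is [2 y] or [4 y] unless [x = y = 1], so that
    [(x - 2 y) (x - 4 y)] is three times the indicator of full rank, and the count
    reduces to the second moments of [x] and [y].  By duality these are sums over
    pairs [(v, w)] of the squared number of syzygies [v f + w h = 0] of bounded
    degree, which only depends on the degree of the primitive direction of
    [(v, w)]; double counting collinear pairs gives the distribution of that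
    degree. *)

From HB Require Import structures.
Require Import Defs.
From mathcomp Require Import all_boot all_order all_algebra mxabelem.
From mathcomp Require Import zify ring lra.

Set Implicit Arguments.
Unset Strict Implicit.
Unset Printing Implicit Defensive.

Import Order.TTheory GRing.Theory Num.Theory.
Local Open Scope ring_scope.

(** * Linear forms on polynomials and kernels of stacked Hankel matrices *)

(** The functional sending each ['X^i] to [a i]. An infinite sequence [a] makes it defined without
    any degree bound. *)
Definition ell {F : fieldType} (a : nat -> F) (p : {poly F}) : F :=
  \sum_(i < size p) p`_i * a i.

Lemma ellE {F : fieldType} (a : nat -> F) (n : nat) (p : {poly F}) :
  (size p <= n)%N -> ell a p = \sum_(i < n) p`_i * a i.
Proof.
move=> le_pn; rewrite /ell (big_ord_widen _ (fun i => p`_i * a i) le_pn) big_mkcond.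
by apply: eq_bigr => i _; case: ltnP => // le_pi; rewrite nth_default // mul0r.
Qed.

Lemma ell_is_linear {F : fieldType} (a : nat -> F) : scalar (ell a).
Proof.
move=> c p q; pose n := maxn (size p) (size q).
rewrite !(@ellE _ a n) ?leq_maxl ?leq_maxr //; last first.
  rewrite (leq_trans (size_polyD _ _)) // geq_max leq_maxr andbT.
  by rewrite (leq_trans (size_scale_leq _ _)) // leq_maxl.
rewrite mulr_sumr -big_split /=; apply: eq_bigr => i _.
by rewrite coefD coefZ mulrDl mulrA.
Qed.

HB.instance Definition _ (F : fieldType) (a : nat -> F) :=
  GRing.isLinear.Build F {poly F} F *%R (ell a) (ell_is_linear a).

Lemma ellXn {F : fieldType} (a : nat -> F) n : ell a 'X^n = a n.
Proof.
rewrite (@ellE _ a n.+1) ?size_polyXn // big_ord_recr /= coefXn eqxx mul1r big1 ?add0r //.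
by move=> i _; rewrite coefXn ltn_eqF // mul0r.
Qed.

Lemma ell_mulXn {F : fieldType} (a : nat -> F) (n j : nat) (p : {poly F}) :
  (size p <= n)%N -> ell a (p * 'X^j) = \sum_(i < n) p`_i * a (i + j)%N.
Proof.
move=> le_pn; rewrite -{1}(coefK p) poly_def mulr_suml raddf_sum /=.
rewrite (big_ord_widen _ (fun i => ell a (p`_i *: 'X^i * 'X^j)) le_pn) big_mkcond.
apply: eq_bigr => i _; case: ltnP => [_|le_pi].
  by rewrite -scalerAl linearZ /= -exprD ellXn.
by rewrite nth_default // mul0r.
Qed.

Lemma ell_mul {F : fieldType} (a : nat -> F) (n : nat) (p q : {poly F}) :
  (size q <= n)%N -> ell a (p * q) = \sum_(j < n) q`_j * ell a (p * 'X^j).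
Proof.
move=> le_qn; rewrite -{1}(coefK q) poly_def mulr_sumr raddf_sum /=.
rewrite (big_ord_widen _ (fun i => ell a (p * (q`_i *: 'X^i))) le_qn) big_mkcond.
apply: eq_bigr => i _; case: ltnP => [_|le_pi].
  by rewrite -scalerAr linearZ.
by rewrite nth_default // mul0r.
Qed.

Lemma size_rVpoly {F : fieldType} n (v : 'rV[F]_n) : (size (rVpoly v) <= n)%N.
Proof. exact: size_poly. Qed.

Lemma rVpoly_eq0 {F : fieldType} n (v : 'rV[F]_n) : (rVpoly v == 0) = (v == 0).
Proof.
apply/eqP/eqP => [v0|->]; last by rewrite linear0.
by apply: (can_inj rVpolyK); rewrite v0 linear0.
Qed.

Definition hankel {F : fieldType} (s k : nat) (a : nat -> F) : 'M[F]_(s, k) :=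
  \matrix_(i, j) a (i + j)%N.

Lemma mul_hankel {F : fieldType} (s k : nat) (a : nat -> F) (v : 'rV[F]_k) j :
  (v *m (hankel s k a)^T) 0 j = ell a (rVpoly v * 'X^j).
Proof.
rewrite mxE (@ell_mulXn _ a k) ?size_rVpoly //; apply: eq_bigr => i _.
by rewrite !mxE coef_rVpoly_ord addnC.
Qed.

(** The space [K] for [(s, k)]. The companion [K'] of [Kset s k.+1 a b] is [Kset s.+1 k a b]. *)
Definition Kset {F : finFieldType} (s k : nat) (a b : nat -> F) : {set 'rV[F]_k} :=
  [set v | [forall j : 'I_s, (ell a (rVpoly v * 'X^j) == 0)
                          && (ell b (rVpoly v * 'X^j) == 0)]].

Lemma KsetP {F : finFieldType} (s k : nat) (a b : nat -> F) (v : 'rV[F]_k) :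
  reflect (forall j, (j < s)%N ->
             ell a (rVpoly v * 'X^j) = 0 /\ ell b (rVpoly v * 'X^j) = 0)
          (v \in Kset s k a b).
Proof.
rewrite inE; apply: (iffP forallP) => [H j lt_js|H j].
  by have /andP[/eqP-> /eqP->] := H (Ordinal lt_js).
by have [-> ->] := H j (ltn_ord j); rewrite eqxx.
Qed.

Lemma mem_Kset_hankel {F : finFieldType} (s k : nat) (a b : nat -> F) (v : 'rV[F]_k) :
  (v \in Kset s k a b) = (v *m (col_mx (hankel s k a) (hankel s k b))^T == 0).
Proof.
rewrite tr_col_mx mul_mx_row; apply/KsetP/eqP => [H|].
  rewrite -[RHS]row_mx0; congr row_mx; apply/rowP => j;
  by rewrite mul_hankel mxE; case: (H j (ltn_ord j)).
rewrite -row_mx0 => /eq_row_mx[Ha Hb] j lt_js.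
by rewrite -!(mul_hankel _ _ (Ordinal lt_js)) Ha Hb !mxE.
Qed.

Lemma card_kermx {F : finFieldType} (m n : nat) (A : 'M[F]_(m, n)) :
  #|[set v : 'rV[F]_m | v *m A == 0]| = (#|F| ^ (m - \rank A))%N.
Proof.
rewrite -mxrank_ker -card_rowg; apply: eq_card => v.
by rewrite !inE sub_kermx.
Qed.

Lemma card_Kset {F : finFieldType} (s k : nat) (a b : nat -> F) :
  #|Kset s k a b|
    = (#|F| ^ (k - \rank (col_mx (hankel s k a) (hankel s k b))))%N.
Proof.
rewrite -mxrank_tr -card_kermx; apply: eq_card => v.
by rewrite mem_Kset_hankel inE.
Qed.

Lemma card_Kset_eq1 {F : finFieldType} (s k : nat) (a b : nat -> F) :
  (\rank (col_mx (hankel s k a) (hankel s k b)) == k) = (#|Kset s k a b| == 1)%N.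
Proof.
have lt1F : (1 < #|F|)%N by apply: card_finNzRing_gt1.
rewrite card_Kset; set r := \rank _.
have le_rk : (r <= k)%N by apply: rank_leq_col.
rewrite -[X in _ = (_ == X)%N](expn0 #|F|) eqn_exp2l //; lia.
Qed.

(** * Comparing the kernels for [(s, k.+1)] and [(s.+1, k)] *)

(** Multiplying a nonzero polynomial by ['X^n] pushes its size above [n]. Pairs are needed for
    relations between two forms; a single polynomial is handled with [q = 0]. *)
Lemma no_X_stable {F : fieldType} (n : nat) (P : {poly F} -> {poly F} -> Prop) :
  (forall p q, P p q -> (size p <= n)%N /\ (size q <= n)%N) ->
  (forall p q, P p q -> P (p * 'X) (q * 'X)) ->
  forall p q, P p q -> p = 0 /\ q = 0.
Proof.
move=> bound stab p q Ppq.
have Pm m : P (p * 'X^m) (q * 'X^m).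
  elim: m => [|m IH]; first by rewrite expr0 !mulr1.
  by rewrite exprSr !mulrA; apply: stab.
have [Hp Hq] := bound _ _ (Pm n).
have aux (r : {poly F}) : (size (r * 'X^n)%R <= n)%N -> r = 0.
  case: (eqVneq r 0) => // r0; rewrite size_mulXn // => Hr.
  have := size_poly_gt0 r; rewrite r0; lia.
by split; apply: aux.
Qed.

(** The three columns hold the obstructions to lying in [K']: the top coefficient and the values of
    the two forms at the extra shift [s]. *)
Definition edge_mx {F : fieldType} (s k : nat) (a b : nat -> F) : 'M[F]_(k.+1, 3) :=
  \matrix_(i, c) nth 0 [:: (i == k :> nat)%:R; a (i + s)%N; b (i + s)%N] c.

Lemma mul_edge {F : fieldType} (s k : nat) (a b : nat -> F) (v : 'rV[F]_k.+1) c :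
  (v *m edge_mx s k a b) 0 c
    = nth 0 [:: (rVpoly v)`_k; ell a (rVpoly v * 'X^s); ell b (rVpoly v * 'X^s)] c.
Proof.
rewrite mxE !(@ell_mulXn _ _ k.+1) ?size_rVpoly //.
case: c => [[|[|[|//]]] lt_c] /=.
- rewrite (bigD1 ord_max) //= !mxE /= eqxx mulr1 -[k in RHS]/(val (@ord_max k)).
  rewrite coef_rVpoly_ord big1 ?addr0 // => i ne_ik; rewrite !mxE /=.
  by rewrite -[k]/(val (@ord_max k)) (inj_eq val_inj) (negbTE ne_ik) mulr0.
- by apply: eq_bigr => i _; rewrite !mxE coef_rVpoly_ord.
- by apply: eq_bigr => i _; rewrite !mxE coef_rVpoly_ord.
Qed.

Lemma mul_edge_eq0 {F : fieldType} (s k : nat) (a b : nat -> F) (v : 'rV[F]_k.+1) :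
  (v *m edge_mx s k a b == 0)
    = [&& (rVpoly v)`_k == 0, ell a (rVpoly v * 'X^s) == 0
        & ell b (rVpoly v * 'X^s) == 0].
Proof.
apply/eqP/and3P => [/rowP H|[/eqP h0 /eqP h1 /eqP h2]].
  split; apply/eqP.
  - by have := H ord0; rewrite mul_edge mxE.
  - by have := H (Ordinal (isT : 1 < 3)%N); rewrite mul_edge mxE.
  - by have := H (Ordinal (isT : 2 < 3)%N); rewrite mul_edge mxE.
by apply/rowP => -[[|[|[|//]]] ?]; rewrite mul_edge mxE.
Qed.

Lemma size_leS {F : fieldType} (k : nat) (p : {poly F}) :
  (size p <= k.+1)%N -> p`_k = 0 -> (size p <= k)%N.
Proof.
move=> le_pk pk0; apply/leq_sizeP => j; rewrite leq_eqVlt => /orP[/eqP <- //|].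
by move=> lt_kj; rewrite nth_default // (leq_trans le_pk).
Qed.

Lemma card_Kset_shift {F : finFieldType} (s k : nat) (a b : nat -> F) :
  #|Kset s.+1 k a b|
    = #|[set v in Kset s k.+1 a b | v *m edge_mx s k a b == 0]|.
Proof.
pose f (v : 'rV[F]_k) : 'rV[F]_k.+1 := poly_rV (rVpoly v).
have fE v : rVpoly (f v) = rVpoly v.
  by rewrite poly_rV_K // (leq_trans (size_rVpoly _)).
have f_inj : injective f.
  by move=> u v /(congr1 rVpoly); rewrite !fE => /(can_inj rVpolyK).
rewrite -(card_imset _ f_inj); apply: eq_card => w; rewrite inE.
apply/imsetP/andP => [[v /KsetP Hv ->]|[/KsetP Hw]].
  split; first by apply/KsetP => j lt_js; rewrite fE; apply: Hv; lia.
  rewrite mul_edge_eq0 fE; have [-> ->] := Hv s (ltnSn s).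
  by rewrite nth_default ?size_rVpoly ?eqxx.
rewrite mul_edge_eq0 => /and3P[/eqP w0 /eqP wa /eqP wb].
have sz_w : (size (rVpoly w) <= k)%N by apply: size_leS; rewrite ?size_rVpoly.
exists (poly_rV (rVpoly w)); last first.
  by apply: (can_inj rVpolyK); rewrite fE poly_rV_K.
apply/KsetP => j; rewrite ltnS leq_eqVlt poly_rV_K // => /orP[/eqP-> //|].
exact: Hw.
Qed.

(** A zero top coefficient keeps [v * 'X] within size [k.+1], and vanishing at shift [s] supplies
    the one new orthogonality condition, so the kernel is stable under multiplication by ['X]. *)
Lemma edge_zero_Kset_trivial {F : finFieldType} (s k : nat) (a b : nat -> F) :
  (forall v, v \in Kset s k.+1 a b -> v *m edge_mx s k a b = 0) ->
  forall v, v \in Kset s k.+1 a b -> v = 0.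
Proof.
move=> H v Kv; apply/eqP; rewrite -rVpoly_eq0; apply/eqP.
pose P (p q : {poly F}) := q = 0 /\ exists2 w, p = rVpoly w & w \in Kset s k.+1 a b.
suff [] : rVpoly v = 0 /\ (0 : {poly F}) = 0 by [].
apply: (@no_X_stable _ k.+1 P) => [p q [-> [w -> _]]|p q [-> [w -> Kw]]|].
- by rewrite size_rVpoly size_poly0.
- have /eqP := H _ Kw; rewrite mul_edge_eq0 => /and3P[/eqP w0 /eqP wa /eqP wb].
  split; first by rewrite mul0r.
  have sz_w : (size (rVpoly w * 'X)%R <= k.+1)%N.
    case: (eqVneq (rVpoly w) 0) => [->|nz]; first by rewrite mul0r size_poly0.
    by rewrite size_mulX // ltnS size_leS ?size_rVpoly.
  exists (poly_rV (rVpoly w * 'X)); first by rewrite poly_rV_K.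
  apply/KsetP => j; rewrite poly_rV_K // -mulrA -exprS leq_eqVlt.
  by move=> /orP[/eqP-> //|lt_js]; move/KsetP: Kw; apply.
- by split=> //; exists v.
Qed.

(* If the edge map is onto, the relations [u1 * a + u2 * b = 0] between the
   shifts of [a] and [b] are stable under multiplication by ['X]: expand
   [a (u1 v X) + b (u2 v X)] along [v] and along [u1, u2]. *)
Lemma edge_onto_no_relation {F : finFieldType} (s k : nat) (a b : nat -> F) :
  (forall t : 'rV[F]_3, exists2 v, v \in Kset s k.+1 a b & v *m edge_mx s k a b = t) ->
  forall u : 'rV[F]_(s + s),
    u *m col_mx (hankel s k.+1 a) (hankel s k.+1 b) = 0 -> u = 0.
Proof.
move=> onto u Hu.
pose P (p q : {poly F}) := [/\ (size p <= s)%N, (size q <= s)%N &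
  forall j, (j < k.+1)%N -> ell a (p * 'X^j) + ell b (q * 'X^j) = 0].
have [] : rVpoly (lsubmx u) = 0 /\ rVpoly (rsubmx u) = 0.
  apply: (@no_X_stable _ s P) => [p q []//|p q [sz_p sz_q Hpq]|].
    have key v : v \in Kset s k.+1 a b ->
        (rVpoly v)`_k * (ell a (p * 'X^(k.+1)) + ell b (q * 'X^(k.+1)))
        = p`_s.-1 * ell a (rVpoly v * 'X^s) + q`_s.-1 * ell b (rVpoly v * 'X^s).
      move=> /KsetP Kv; transitivity (ell a (p * 'X * rVpoly v) + ell b (q * 'X * rVpoly v)).
        rewrite !(@ell_mul _ _ k.+1 _ (rVpoly v)) ?size_rVpoly // -big_split /=.
        rewrite big_ord_recr /= big1 => [|i _].
          by rewrite add0r -!mulrA -!exprS mulrDr.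
        by rewrite -!mulrA -!exprS -mulrDr Hpq ?mulr0 // ltnS ltn_ord.
      have aux c (r : {poly F}) : (size r <= s)%N ->
          (forall j, (j < s)%N -> ell c (rVpoly v * 'X^j) = 0) ->
          ell c (r * 'X * rVpoly v) = r`_s.-1 * ell c (rVpoly v * 'X^s).
        move=> sz_r Hc; case: s sz_r Hc {Kv onto Hu u P sz_p sz_q Hpq} => [|s] sz_r Hc.
          by move: sz_r; rewrite leqn0 size_poly_eq0 => /eqP->; rewrite !mul0r coef0 linear0 mul0r.
        rewrite -mulrA mulrC [X in ell c X](_ : _ = ('X * rVpoly v) * r) //.
        rewrite (@ell_mul _ _ s.+1) // big_ord_recr /= big1 => [|i _].
          by rewrite add0r ['X * _]mulrC -mulrA -exprS.
        by rewrite ['X * _]mulrC -mulrA -exprS Hc ?mulr0 // ltnS ltn_ord.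
      by congr (_ + _); apply: aux => // j lt_js; case: (Kv j lt_js).
    (* Unit vectors as edge values: the first extends the relation to shift [k.+1], the other two
       kill the coefficients of [p] and [q] at [s.-1], so that [p * 'X] and [q * 'X] keep size at
       most [s]. *)
    have [v0 K0 E0] := onto (delta_mx 0 0).
    have [v1 K1 E1] := onto (delta_mx 0 (inord 1)).
    have [v2 K2 E2] := onto (delta_mx 0 (inord 2)).
    have get v i c : v *m edge_mx s k a b = delta_mx 0 (inord i) -> (i < 3)%N -> (c < 3)%N ->
      nth 0 [:: (rVpoly v)`_k; ell a (rVpoly v * 'X^s); ell b (rVpoly v * 'X^s)] c = (c == i)%:R.
      move=> E lt_i lt_c; have /rowP/(_ (inord c)) := E.
      by rewrite mul_edge mxE eqxx /= inordK // -(inj_eq val_inj) /= !inordK.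
    have E0' : v0 *m edge_mx s k a b = delta_mx 0 (inord 0).
      by rewrite E0; congr delta_mx; apply: val_inj; rewrite /= inordK.
    have := key _ K0; have /= -> := get _ 0%N 0%N E0' isT isT.
    have /= -> := get _ 0%N 1%N E0' isT isT; have /= -> := get _ 0%N 2%N E0' isT isT.
    rewrite !mulr0 mul1r addr0 => Hk.
    have := key _ K1; have /= -> := get _ 1%N 0%N E1 isT isT.
    have /= -> := get _ 1%N 1%N E1 isT isT; have /= -> := get _ 1%N 2%N E1 isT isT.
    rewrite mul0r mulr1 mulr0 addr0 => /esym Hp.
    have := key _ K2; have /= -> := get _ 2%N 0%N E2 isT isT.
    have /= -> := get _ 2%N 1%N E2 isT isT; have /= -> := get _ 2%N 2%N E2 isT isT.
    rewrite mul0r mulr1 mulr0 add0r => /esym Hq.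
    have szX (r : {poly F}) : (size r <= s)%N -> r`_s.-1 = 0 -> (size (r * 'X)%R <= s)%N.
      case: (eqVneq r 0) => [->|nz]; first by rewrite mul0r size_poly0.
      rewrite size_mulX //; have := nz; rewrite -size_poly_gt0.
      case: (s) => [|s'] /=; first by lia.
      by move=> _ sz_r r0; rewrite ltnS size_leS.
    split; [exact: szX | exact: szX | move=> j].
    rewrite -!mulrA -!exprS ltnS leq_eqVlt => /orP[/eqP-> //|lt_jk]; exact: Hpq.
  split; rewrite ?size_rVpoly // => j lt_jk.
  have := Hu; rewrite -{1}(hsubmxK u) mul_row_col => /rowP/(_ (Ordinal lt_jk)).
  rewrite !mxE /= => <-; rewrite !(@ell_mulXn _ _ s) ?size_rVpoly //.
  by congr (_ + _); apply: eq_bigr => i _; rewrite coef_rVpoly_ord !mxE.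
move=> /eqP; rewrite rVpoly_eq0 => /eqP l0 /eqP; rewrite rVpoly_eq0 => /eqP r0.
by rewrite -(hsubmxK u) l0 r0 row_mx0.
Qed.

(** By rank-nullity [x = #|F| ^ d * y], with [d] the rank of the edge map on [K]. For nonzero [K],
    [d = 0] is excluded by stability under ['X]; [d = 3] would make all [s + s] rows independent,
    and [k.+1 <= s + s] would then force [K] to be zero. *)
Lemma card_Kset_step {F : finFieldType} (s k : nat) (a b : nat -> F) :
  (k.+1 <= s + s)%N ->
  let x := #|Kset s k.+1 a b| in let y := #|Kset s.+1 k a b| in
  (x = 1 /\ y = 1)%N \/ (1 < x)%N /\ (x = #|F| * y \/ x = #|F| ^ 2 * y)%N.
Proof.
move=> le_ks x y; set A := (col_mx (hankel s k.+1 a) (hankel s k.+1 b))^T.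
set B := edge_mx s k a b.
have lt1F : (1 < #|F|)%N by apply: card_finNzRing_gt1.
have memK v : (v \in Kset s k.+1 a b) = (v <= kermx A)%MS.
  by rewrite mem_Kset_hankel sub_kermx.
have xE : x = (#|F| ^ \rank (kermx A))%N.
  by rewrite -card_rowg; apply: eq_card => v; rewrite memK !inE.
have yE : y = (#|F| ^ \rank (kermx A :&: kermx B)%MS)%N.
  rewrite -card_rowg /y card_Kset_shift; apply: eq_card => v.
  by rewrite !inE sub_capmx -memK !inE sub_kermx.
have := mxrank_mul_ker (kermx A) B; set d := \rank (_ *m B).
have le_d3 : (d <= 3)%N by apply: rank_leq_col.
move=> rkK.
case: (posnP (\rank (kermx A))) => [r0|r_gt0].
  by left; rewrite xE yE; move: rkK; rewrite r0 => /eqP; rewrite addn_eq0 => /andP[_ /eqP->].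
right; split; first by rewrite xE -[X in (X < _)%N](expn0 #|F|) ltn_exp2l.
have d_neq0 : (d != 0)%N.
  apply/eqP => d0.
  have KB : kermx A *m B = 0 by apply/eqP; rewrite -mxrank_eq0 -/d d0.
  have HB v : v \in Kset s k.+1 a b -> v *m B = 0.
    by rewrite memK => /submxP[w ->]; rewrite -mulmxA KB mulmx0.
  have K0 := edge_zero_Kset_trivial HB.
  have : kermx A = 0.
    apply/row_matrixP => i; rewrite row0; apply: K0.
    by rewrite memK row_sub.
  by move/eqP; rewrite -mxrank_eq0; move: r_gt0; case: (\rank _).
have d_neq3 : (d != 3)%N.
  apply/eqP => d3.
  have onto t : exists2 v, v \in Kset s k.+1 a b & v *m B = t.
    have : (t <= kermx A *m B)%MS by apply: submx_full; rewrite /row_full -/d d3.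
    case/submxP => w ->; exists (w *m kermx A); last by rewrite mulmxA.
    by rewrite memK submxMl.
  have inj := edge_onto_no_relation onto.
  have rA : \rank A = (s + s)%N.
    rewrite mxrank_tr; apply/eqP; rewrite -[_ == _]/(row_free _) -kermx_eq0.
    apply/eqP/row_matrixP => i; rewrite row0; apply: inj.
    by apply/eqP; rewrite -sub_kermx row_sub.
  have := mxrank_ker A; rewrite rA; lia.
have [d1|d2] : (d = 1 \/ d = 2)%N by lia.
- by left; rewrite xE yE -rkK d1 expnD expn1.
- by right; rewrite xE yE -rkK d2 expnD.
Qed.

(** * Parametrising persymmetric matrices by coefficient vectors *)

(** Entries from [N] on read as 0; an [s] by [k] Hankel matrix with [s + k = N.+1] only uses indices
    below [N]. *)
Definition cf {F : fieldType} (N : nat) (u : 'rV[F]_N) (n : nat) : F := (rVpoly u)`_n.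

Lemma cf_inj {F : fieldType} (N : nat) (u v : 'rV[F]_N) :
  (forall n, (n < N)%N -> cf u n = cf v n) -> u = v.
Proof.
by move=> H; apply/rowP => i; have := H i (ltn_ord i); rewrite /cf !coef_rVpoly_ord.
Qed.

Lemma persymmetric_hankel (s k : nat) (a : nat -> 'F_2) : persymmetric (hankel s k a).
Proof.
apply/forallP => i; apply/forallP => j; apply/forallP => i'; apply/forallP => j'.
by apply/implyP => /eqP E; rewrite !mxE E.
Qed.

Lemma persymmetric_is_hankel (s k N : nat) (A : 'M['F_2]_(s, k)) :
  (0 < s)%N -> (0 < k)%N -> (s + k = N.+1)%N -> persymmetric A ->
  exists u : 'rV_N, A = hankel s k (cf u).
Proof.
case: s A => // s; case: k => // k A _ _ sk pA.
(* One representative per anti-diagonal: down the first column, then along the last row, whose index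
   is [s] after the case split. *)
exists (\row_(n < N) A (inord (minn n s)) (inord (n - minn n s))).
apply/matrixP => i j; have [ltis ltjk] := (ltn_ord i, ltn_ord j).
have lt_ij : (i + j < N)%N by lia.
rewrite mxE /cf -[(i + j)%N]/(val (Ordinal lt_ij)) coef_rVpoly_ord mxE /=.
move/forallP/(_ i)/forallP/(_ j): pA.
move=> /forallP/(_ (inord (minn (i + j) s)))/forallP.
move=> /(_ (inord (i + j - minn (i + j) s)))/implyP H; apply/eqP/H.
rewrite !inordK //; lia.
Qed.

Lemma hankel_inj {F : fieldType} (s k N : nat) (u v : 'rV[F]_N) :
  (0 < s)%N -> (0 < k)%N -> (s + k = N.+1)%N ->
  hankel s k (cf u) = hankel s k (cf v) -> u = v.
Proof.
case: s => // s; case: k => // k _ _ sk /matrixP H; apply: cf_inj => n lt_n.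
have := H (inord (minn n s)) (inord (n - minn n s)); rewrite !mxE !inordK; try lia.
by rewrite subnKC // geq_minl.
Qed.

Lemma Gamma_card (s k N : nat) :
  (0 < s)%N -> (0 < k)%N -> (s + k = N.+1)%N ->
  Gamma s k k
    = #|[set ab : 'rV['F_2]_N * 'rV['F_2]_N | #|Kset s k (cf ab.1) (cf ab.2)| == 1%N]|.
Proof.
move=> s0 k0 sk.
pose f (ab : 'rV['F_2]_N * 'rV['F_2]_N) :=
  col_mx (hankel s k (cf ab.1)) (hankel s k (cf ab.2)).
have f_inj : injective f.
  move=> [a b] [a' b'] /eq_col_mx[/= Ha Hb].
  by rewrite (hankel_inj s0 k0 sk Ha) (hankel_inj s0 k0 sk Hb).
rewrite /Gamma -(card_imset _ f_inj); apply: eq_card => M; rewrite inE.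
apply/andP/imsetP => [[/existsP[A /existsP[B /and3P[pA pB /eqP ->]]] rM]|[[a b]]].
  have [a Ea] := persymmetric_is_hankel s0 k0 sk pA.
  have [b Eb] := persymmetric_is_hankel s0 k0 sk pB.
  by exists (a, b); rewrite ?inE -?card_Kset_eq1 /f -?Ea -?Eb.
rewrite inE -card_Kset_eq1 => rk ->; split=> //.
apply/existsP; exists (hankel s k (cf a)); apply/existsP; exists (hankel s k (cf b)).
by rewrite !persymmetric_hankel eqxx.
Qed.

(** * Second moments of the kernel sizes *)

Definition orth {F : fieldType} (N s : nat) (u : 'rV[F]_N) (p : {poly F}) : bool :=
  [forall j : 'I_s, ell (cf u) (p * 'X^j) == 0].

Lemma mem_Kset_orth {F : finFieldType} (N s k : nat) (a b : 'rV[F]_N) v :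
  (v \in Kset s k (cf a) (cf b)) = orth s a (rVpoly v) && orth s b (rVpoly v).
Proof.
rewrite inE; apply/forallP/andP => [H|[/forallP Ha /forallP Hb] j].
  by split; apply/forallP => j; case/andP: (H j).
by rewrite Ha Hb.
Qed.

(** After exchanging sums, for fixed [(v, w)] the conditions on [a] and on [b] are the same and
    independent, whence the square. *)
Lemma sum_card_Kset {F : finFieldType} (N s k s' k' : nat) :
  (\sum_(ab : 'rV[F]_N * 'rV[F]_N)
     #|Kset s k (cf ab.1) (cf ab.2)| * #|Kset s' k' (cf ab.1) (cf ab.2)|
   = \sum_(v : 'rV[F]_k) \sum_(w : 'rV[F]_k')
       #|[set u : 'rV[F]_N | orth s u (rVpoly v) && orth s' u (rVpoly w)]| ^ 2)%N.
Proof.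
pose o (u : 'rV[F]_N) (v : 'rV[F]_k) (w : 'rV[F]_k') : nat :=
  orth s u (rVpoly v) && orth s' u (rVpoly w).
transitivity (\sum_(ab : 'rV[F]_N * 'rV[F]_N)
  \sum_(v : 'rV[F]_k) \sum_(w : 'rV[F]_k') (o ab.1 v w * o ab.2 v w))%N.
  apply: eq_bigr => -[a b] _ /=; rewrite -!sum1_card big_mkcond big_distrlr /=.
  apply: eq_bigr => v _; rewrite big_mkcond; apply: eq_bigr => w _; rewrite !mem_Kset_orth /o.
  by do 4![case: (orth _ _ _)].
rewrite exchange_big; apply: eq_bigr => v _; rewrite exchange_big.
apply: eq_bigr => w _; rewrite -(pair_bigA _ (fun a b => o a v w * o b v w)%N) /=.
rewrite -mulnn -sum1_card [in RHS]big_mkcond big_distrlr /=.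
apply: eq_bigr => a _; apply: eq_bigr => b _; rewrite !inE /o.
by do 2![case: (_ && _)].
Qed.

Definition shifts_mx {F : fieldType} (s N : nat) (p : {poly F}) : 'M[F]_(s, N) :=
  \matrix_(j < s) poly_rV (p * 'X^j).

Lemma mul_shifts {F : fieldType} (s N : nat) (p : {poly F}) (f : 'rV[F]_s) :
  f *m shifts_mx s N p = poly_rV (p * rVpoly f).
Proof.
rewrite mulmx_sum_row [in RHS](row_sum_delta f) !linear_sum mulr_sumr linear_sum.
by apply: eq_bigr => i _; rewrite rowK linearZ /= rVpoly_delta -scalerAr linearZ.
Qed.

Lemma size_mul_bound {F : fieldType} (s k N : nat) (p q : {poly F}) :
  (s + k = N.+1)%N -> (size p <= k)%N -> (size q <= s)%N -> (size (p * q)%R <= N)%N.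
Proof. by move=> sk sp sq; apply: leq_trans (size_polyMleq _ _) _; lia. Qed.

Lemma orthE {F : fieldType} (s k N : nat) (u : 'rV[F]_N) (p : {poly F}) :
  (s + k = N.+1)%N -> (size p <= k)%N ->
  orth s u p = (u *m (shifts_mx s N p)^T == 0).
Proof.
move=> sk sp.
have E (j : 'I_s) : ell (cf u) (p * 'X^j) = (u *m (shifts_mx s N p)^T) 0 j.
  rewrite (@ellE _ _ N); last by apply: size_mul_bound sk sp _; rewrite size_polyXn.
  by rewrite mxE; apply: eq_bigr => i _; rewrite !mxE /cf coef_rVpoly_ord mulrC.
apply/forallP/eqP => [H|H j]; last by rewrite E H mxE.
by apply/rowP => j; rewrite -E mxE; apply/eqP.
Qed.

(** The vectors [u] form the annihilator of the row space of [C], and the syzygies form its left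
    kernel. Both dimensions depend on [\rank C] alone, which cancels between the two sides. *)
Lemma card_orth {F : finFieldType} (s k s' k' N : nat) (v w : {poly F}) :
  (s + k = N.+1)%N -> (s' + k' = N.+1)%N -> (size v <= k)%N -> (size w <= k')%N ->
  (#|[set u : 'rV[F]_N | orth s u v && orth s' u w]| * #|F| ^ (s + s')
   = #|F| ^ N * #|[set fh : 'rV[F]_s * 'rV[F]_s' |
                    (v * rVpoly fh.1 + w * rVpoly fh.2 == 0)%R]|)%N.
Proof.
move=> sk sk' sv sw; set C := col_mx (shifts_mx s N v) (shifts_mx s' N w).
have -> : #|[set u : 'rV[F]_N | orth s u v && orth s' u w]| = (#|F| ^ (N - \rank C))%N.
  rewrite -(mxrank_tr C) -card_kermx; apply: eq_card => u; rewrite !inE.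
  rewrite (orthE u sk sv) (orthE u sk' sw) /C tr_col_mx mul_mx_row.
  apply/andP/eqP => [[/eqP-> /eqP->]|]; first by rewrite row_mx0.
  by rewrite -row_mx0 => /eq_row_mx[-> ->].
have -> : #|[set fh : 'rV[F]_s * 'rV[F]_s' | v * rVpoly fh.1 + w * rVpoly fh.2 == 0]|
    = (#|F| ^ (s + s' - \rank C))%N.
  rewrite -card_kermx; pose g (fh : 'rV[F]_s * 'rV[F]_s') := row_mx fh.1 fh.2.
  have g_inj : injective g by move=> [f h] [f' h'] /eq_row_mx[/= -> ->].
  rewrite -(card_imset _ g_inj); apply: eq_card => u; rewrite !inE.
  have key f h : (row_mx f h *m C == 0) = (v * rVpoly f + w * rVpoly h == 0).
    rewrite mul_row_col !mul_shifts -linearD /= -rVpoly_eq0 poly_rV_K //.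
    rewrite (leq_trans (size_polyD _ _)) // geq_max.
    by rewrite (size_mul_bound sk) ?(size_mul_bound sk') ?size_rVpoly.
  apply/imsetP/idP => [[[f h]]|]; first by rewrite inE -key => H ->.
  move=> H; exists (lsubmx u, rsubmx u); last by rewrite /g /= hsubmxK.
  by rewrite inE -key hsubmxK.
rewrite -!expnD; congr (_ ^ _)%N.
have := rank_leq_row C; have := rank_leq_col C; lia.
Qed.

(** * Counting collinear pairs of polynomials *)

(* The degree of the primitive direction of [(v, w)], the second coordinate
   being given weight [d]. *)
Definition wdeg {F : fieldType} (d : nat) (v w : {poly F}) : nat :=
  (maxn (size v) (size (w * 'X^d)%R) - size (gcdp v w))%N.

(** Division by the gcd leaves the primitive pair; degrees add in a product, so the two bounds merge
    into a single bound on [t]. *)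
Lemma size_mul_wdeg {F : fieldType} (d m : nat) (v w t : {poly F}) :
  (v != 0) || (w != 0) ->
  let g := gcdp v w in
  ((size (t * (v %/ g))%R <= m) && (size (t * (w %/ g))%R <= m - d))%N
    = (size t <= m - wdeg d v w)%N.
Proof.
move=> nz g; have g0 : g != 0 by rewrite gcdp_eq0 negb_and.
have vE : v = v %/ g * g by rewrite divpK // dvdp_gcdl.
have wE : w = w %/ g * g by rewrite divpK // dvdp_gcdr.
have eE : wdeg d v w = (maxn (size (v %/ g * g)%R) (size (w %/ g * g * 'X^d)%R) - size g)%N.
  by rewrite -vE -wE.
have : (v %/ g != 0) || (w %/ g != 0).
  by move: nz; rewrite {1}vE {1}wE !mulf_eq0 !negb_or g0 !andbT.
rewrite {}eE; move: (v %/ g) (w %/ g) => v' w' {vE wE nz}.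
have sg : (0 < size g)%N by rewrite size_poly_gt0.
case: (eqVneq t 0) => [-> _|t0]; first by rewrite !mul0r !size_poly0.
have st : (0 < size t)%N by rewrite size_poly_gt0.
have smul (p q : {poly F}) :
    p != 0 -> q != 0 -> size (p * q)%R = (size p + size q).-1 by exact: size_mul.
(* The size formula for products fails at a zero factor, hence one arithmetic fact for each pattern
   of zero coordinates in the primitive pair. *)
have aux0 x y z : (0 < x -> 0 < y -> 0 < z ->
    (0 <= m) && ((x + y).-1 <= m - d) = (x <= m - (maxn 0 (d + (y + z).-1) - z)))%N by lia.
have aux1 x y z : (0 < x -> 0 < y -> 0 < z ->
    ((x + y).-1 <= m) && (0 <= m - d) = (x <= m - (maxn (y + z).-1 0 - z)))%N by lia.
have aux2 x y y' z : (0 < x -> 0 < y -> 0 < y' -> 0 < z ->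
    ((x + y).-1 <= m) && ((x + y').-1 <= m - d)
      = (x <= m - (maxn (y + z).-1 (d + (y' + z).-1) - z)))%N by lia.
case: (eqVneq v' 0) => [->|v0]; case: (eqVneq w' 0) => [->|w0] //= _;
  rewrite ?mulr0 ?mul0r ?size_poly0 ?size_mulXn ?mulf_neq0 ?smul //.
- have sw : (0 < size w')%N by rewrite size_poly_gt0.
  by apply: (aux0 (size t) (size w') (size g)).
- have sv : (0 < size v')%N by rewrite size_poly_gt0.
  by apply: (aux1 (size t) (size v') (size g)).
- have sw : (0 < size w')%N by rewrite size_poly_gt0.
  have sv : (0 < size v')%N by rewrite size_poly_gt0.
  by apply: (aux2 (size t) (size v') (size w') (size g)).
Qed.

Definition line {F : finFieldType} (m n : nat) (v w : {poly F}) :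
    {set 'rV[F]_m * 'rV[F]_n} :=
  [set q | rVpoly q.1 * w == rVpoly q.2 * v].

(** The pairs on the line are the multiples [(t * v', t * w')] of the primitive pair, and their size
    bounds amount to one bound on [t]. *)
Lemma card_line {F : finFieldType} (d m : nat) (v w : {poly F}) :
  (v != 0) || (w != 0) -> #|line m (m - d) v w| = (#|F| ^ (m - wdeg d v w))%N.
Proof.
move=> nz; have bound t := @size_mul_wdeg _ d m v w t nz; move: bound => /=.
set g := gcdp v w; set v' := v %/ g; set w' := w %/ g => bound.
have g0 : g != 0 by rewrite gcdp_eq0 negb_and.
have vE : v = v' * g by rewrite divpK // dvdp_gcdl.
have wE : w = w' * g by rewrite divpK // dvdp_gcdr.
have /Bezout_eq1_coprimepP[[a b] /= ab1] : coprimep v' w' by apply: coprimep_div_gcd.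
have lineE p q : (p * w == q * v) = (p * w' == q * v').
  by rewrite wE vE !mulrA (inj_eq (mulIf g0)).
pose f (t : 'rV[F]_(m - wdeg d v w)) : 'rV[F]_m * 'rV[F]_(m - d) :=
  (poly_rV (rVpoly t * v'), poly_rV (rVpoly t * w')).
have fE t : rVpoly (f t).1 = rVpoly t * v' /\ rVpoly (f t).2 = rVpoly t * w'.
  have := bound (rVpoly t); rewrite size_rVpoly => /andP[s1 s2].
  by rewrite !poly_rV_K.
have f_inj : injective f.
  move=> t u E; apply: (can_inj rVpolyK).
  have [t1 t2] := fE t; have [u1 u2] := fE u.
  rewrite -[LHS]mulr1 -[RHS]mulr1 -ab1 !mulrDr ![_ * (a * _)]mulrCA ![_ * (b * _)]mulrCA.
  by rewrite -t1 -t2 -u1 -u2 E.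
have <- : #|'rV[F]_(m - wdeg d v w)| = (#|F| ^ (m - wdeg d v w))%N.
  by rewrite card_mx mul1n.
rewrite -cardsT -(card_imset _ f_inj); apply: eq_card => -[p q].
apply/idP/imsetP => [|[t _ ->]]; rewrite inE /= lineE.
  (* The Bezout relation [a * v' + b * w' = 1] recovers the multiplier from the pair. *)
  move=> /eqP E; pose t := a * rVpoly p + b * rVpoly q.
  have tv : t * v' = rVpoly p.
    by rewrite -[RHS]mulr1 -ab1 /t; ring: E.
  have tw : t * w' = rVpoly q.
    by rewrite -[RHS]mulr1 -ab1 /t; ring: E.
  have st : (size t <= m - wdeg d v w)%N by rewrite -bound tv tw !size_rVpoly.
  exists (poly_rV t) => //; have [h1 h2] := fE (poly_rV t).
  rewrite (surjective_pairing (f _)); congr (_, _); apply: (can_inj rVpolyK).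
    by rewrite h1 poly_rV_K.
  by rewrite h2 poly_rV_K.
by have [-> ->] := fE t; rewrite mulrAC.
Qed.

Lemma collinear_trans {F : fieldType} (p q v w r t : {poly F}) :
  (v != 0) || (w != 0) -> v * t = w * r -> p * w = q * v -> p * t = q * r.
Proof.
move=> nz E1 E2; case/orP: nz => nz; apply: (mulIf nz).
  by rewrite -mulrA [t * v]mulrC E1 mulrA E2 mulrAC.
by rewrite mulrAC E2 -mulrA E1 mulrA mulrAC.
Qed.

(** Collinear nonzero pairs span the same line, whose cardinality determines the degree. The choice
    of [m] is large enough for both subtractions to be exact. *)
Lemma wdeg_collinear {F : finFieldType} (d : nat) (v w r t : {poly F}) :
  (v != 0) || (w != 0) -> (r != 0) || (t != 0) -> v * t = w * r ->
  wdeg d v w = wdeg d r t.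
Proof.
move=> nz nz' E; set m := (wdeg d v w + wdeg d r t)%N.
have := @card_line _ d m v w nz; have := @card_line _ d m r t nz'.
have -> : line m (m - d) v w = line m (m - d) r t.
  apply/setP => -[p q]; rewrite !inE /=; apply/eqP/eqP => H.
    exact: (collinear_trans nz E H).
  by apply: (collinear_trans nz' _ H); rewrite mulrC -E mulrC.
move=> -> /eqP; rewrite eqn_exp2l ?card_finNzRing_gt1 // /m; lia.
Qed.

(** * Distribution of the direction degree *)

Definition dircount (F : finFieldType) (d k e : nat) : nat :=
  #|[set p : 'rV[F]_k * 'rV[F]_(k - d) |
      (p != 0) && (wdeg d (rVpoly p.1) (rVpoly p.2) == e)]|.

Lemma pair_rV_neq0 {F : fieldType} (m n : nat) (p : 'rV[F]_m * 'rV[F]_n) :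
  (p != 0) = (rVpoly p.1 != 0) || (rVpoly p.2 != 0).
Proof. by case: p => u v; rewrite !rVpoly_eq0 -negb_and. Qed.

(* Double count the collinear pairs [(p, r)] of direction degree [e]. *)
Lemma dircount_sym (F : finFieldType) (d k m e : nat) :
  (dircount F d k e * (#|F| ^ (m - e) - 1) = dircount F d m e * (#|F| ^ (k - e) - 1))%N.
Proof.
pose S n := [set p : 'rV[F]_n * 'rV[F]_(n - d) |
      (p != 0) && (wdeg d (rVpoly p.1) (rVpoly p.2) == e)].
pose col m n (p : 'rV[F]_m * 'rV[F]_(m - d)) (r : 'rV[F]_n * 'rV[F]_(n - d)) :=
  rVpoly p.1 * rVpoly r.2 == rVpoly p.2 * rVpoly r.1.
have fib i n (p : 'rV[F]_i * 'rV[F]_(i - d)) : p \in S i ->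
    (\sum_(r in S n) col i n p r = #|F| ^ (n - e) - 1)%N.
  rewrite inE pair_rV_neq0 => /andP[p0 /eqP pe].
  rewrite -pe -(card_line d n p0) (cardsD1 (0 : 'rV[F]_n * 'rV[F]_(n - d))).
  rewrite inE !linear0 !mul0r eqxx addKn.
  rewrite -sum1_card big_mkcond [RHS]big_mkcond; apply: eq_bigr => r _.
  rewrite !inE /col; case: (eqVneq r 0) => //= r0.
  rewrite [_ * rVpoly p.2]mulrC [rVpoly r.2 * _]mulrC [_ * _ == _]eq_sym.
  case: (eqVneq (rVpoly p.1 * rVpoly r.2) _) => [E|]; last by case: ifP.
  rewrite pair_rV_neq0 in r0.
  by rewrite (wdeg_collinear d p0 r0 E) in pe; rewrite pe eqxx.
transitivity (\sum_(p in S k) \sum_(r in S m) col k m p r)%N.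
  by rewrite (eq_bigr _ (fib k m)) sum_nat_const.
rewrite exchange_big /= -sum_nat_const; apply: eq_bigr => r Sr.
rewrite -(fib m k r Sr); apply: eq_bigr => p _; rewrite /col.
by rewrite eq_sym [_ * rVpoly r.1]mulrC [_ * rVpoly r.2]mulrC.
Qed.

(** The line through [p] contains both 0 and [p], so its cardinality [#|F| ^ (k - e)] exceeds 1. *)
Lemma wdeg_lt {F : finFieldType} (d k : nat) (p : 'rV[F]_k * 'rV[F]_(k - d)) :
  p != 0 -> (wdeg d (rVpoly p.1) (rVpoly p.2) < k)%N.
Proof.
move=> p0; have p0' := p0; rewrite pair_rV_neq0 in p0'.
have := card_line d k p0'; set e := wdeg _ _ _.
rewrite (cardsD1 (0 : 'rV[F]_k * 'rV[F]_(k - d))) inE !linear0 !mul0r eqxx.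
rewrite (cardsD1 p) !inE p0 mulrC eqxx ltnNge; case: leqP => // le_ke.
by move: le_ke; rewrite -subn_eq0 => /eqP ->; rewrite expn0.
Qed.

Lemma sum_wdeg (F : finFieldType) (d k : nat) (phi : nat -> nat) :
  (\sum_(p : 'rV[F]_k * 'rV[F]_(k - d) | p != 0%R) phi (wdeg d (rVpoly p.1) (rVpoly p.2))
   = \sum_(e < k) dircount F d k e * phi e)%N.
Proof.
case: k => [|k].
  rewrite big_ord0 big1 // => -[u v] /eqP[].
  rewrite (thinmx0 u); congr (_, _); exact: thinmx0.
rewrite (partition_big (fun p => inord (wdeg d (rVpoly p.1) (rVpoly p.2)) : 'I_k.+1) predT) //=.
apply: eq_bigr => e _; rewrite /dircount -sum_nat_const.
rewrite big_mkcond [RHS]big_mkcond; apply: eq_bigr => p _; rewrite inE.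
case: (eqVneq p 0) => //= p0; rewrite -val_eqE /= inordK ?wdeg_lt //.
by case: eqP => // ->.
Qed.

(** The number of primitive directions of degree [e]: under the bound [e.+1] a line of degree [e]
    has exactly one nonzero point over the two-element field. *)
Definition dirs (d e : nat) : nat := dircount 'F_2 d e.+1 e.

Lemma dircountE (d k e : nat) : (dircount 'F_2 d k e = dirs d e * (2 ^ (k - e) - 1))%N.
Proof.
have := @dircount_sym 'F_2 d k e.+1 e; rewrite card_Fp // subSnn expn1 subn1 muln1.
by move=> ->.
Qed.

(** Sorting all nonzero pairs by direction degree. Letting [k] vary, these equations determine
    [dirs]. *)
Lemma sum_dirs (d k : nat) :
  (\sum_(e < k) dirs d e * (2 ^ (k - e) - 1) + 1 = 2 ^ (k + (k - d)))%N.
Proof.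
have := sum_wdeg 'F_2 d k (fun=> 1%N); rewrite sum1_card.
under eq_bigr do rewrite muln1 dircountE.
move=> <-; rewrite addn1.
have <- : #|{: 'rV['F_2]_k * 'rV['F_2]_(k - d)}| = (2 ^ (k + (k - d)))%N.
  by rewrite card_prod !card_mx card_Fp // !mul1n expnD.
rewrite [RHS](cardD1 (0 : 'rV['F_2]_k * 'rV['F_2]_(k - d))) -[LHS]add1n.
by congr (_ + _)%N; apply: eq_card => p; rewrite !inE andbT.
Qed.

(** * Syzygies and evaluation of the moments *)

(** A syzygy [(f, h)] is a point [(h, - f)] of the line through [(v, w)]. *)
Lemma card_syzygy {F : finFieldType} (d s : nat) (v w : {poly F}) :
  (v != 0) || (w != 0) ->
  #|[set fh : 'rV[F]_s * 'rV[F]_(s + d) | v * rVpoly fh.1 + w * rVpoly fh.2 == 0]|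
    = (#|F| ^ (s + d - wdeg d v w))%N.
Proof.
move=> nz; rewrite -card_line // [in RHS]addnK.
pose f (q : 'rV[F]_(s + d) * 'rV[F]_s) := (- q.2, q.1).
have f_inj : injective f by move=> [a b] [a' b'] [/oppr_inj-> ->].
rewrite -(card_imset _ f_inj); apply: eq_card => -[a b]; rewrite inE /=.
apply/idP/imsetP => [E|[[b' a']]].
  exists (b, - a); last by rewrite /f /= opprK.
  by rewrite inE /= linearN /= mulNr -addr_eq0 addrC mulrC [_ * w]mulrC.
rewrite inE /= => E [-> ->].
by rewrite linearN /= mulrN addrC subr_eq0 mulrC [v * _]mulrC.
Qed.

(** With [d = 0] this is the second moment of one kernel size, with [d = 1] the mixed moment of [x]
    and [y]. The zero pair [(v, w)] gives the isolated term; the others are grouped by direction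
    degree. *)
Lemma second_moment (d s k k' s' N : nat) :
  (s + k = N.+1)%N -> (d <= k)%N -> k' = (k - d)%N -> s' = (s + d)%N ->
  ((\sum_(ab : 'rV['F_2]_N * 'rV['F_2]_N)
     #|Kset s k (cf ab.1) (cf ab.2)| * #|Kset s' k' (cf ab.1) (cf ab.2)|) * 4 ^ (s + s')
   = 4 ^ N * (4 ^ (s + s')
       + \sum_(e < k) dirs d e * (2 ^ (k - e) - 1) * 4 ^ (s + d - e)))%N.
Proof.
move=> sk le_dk -> ->; rewrite sum_card_Kset.
have four n : (4 ^ n = 2 ^ n * 2 ^ n)%N by rewrite -expnMn.
pose Z (p : 'rV['F_2]_k * 'rV['F_2]_(k - d)) :=
  #|[set fh : 'rV['F_2]_s * 'rV['F_2]_(s + d) |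
      (rVpoly p.1 * rVpoly fh.1 + rVpoly p.2 * rVpoly fh.2 == 0)%R]|.
have term (p : 'rV['F_2]_k * 'rV['F_2]_(k - d)) :
   (#|[set u : 'rV['F_2]_N | orth s u (rVpoly p.1) && orth (s + d) u (rVpoly p.2)]| ^ 2
    * 4 ^ (s + (s + d)) = 4 ^ N * Z p ^ 2)%N.
  have sk' : (s + d + (k - d) = N.+1)%N by lia.
  have := card_orth sk sk' (size_rVpoly p.1) (size_rVpoly p.2); rewrite card_Fp // -/(Z p).
  move=> E; rewrite !four -!mulnn; move: E; set x := #|_|; nia.
rewrite pair_bigA /= big_distrl /= (eq_bigr _ (fun p _ => term p)) -big_distrr /=.
congr (_ * _)%N; rewrite (bigD1 (0 : 'rV['F_2]_k * 'rV['F_2]_(k - d))) //=; congr (_ + _)%N.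
  rewrite four -mulnn /Z; suff -> : #|[set fh : 'rV['F_2]_s * 'rV['F_2]_(s + d) |
      (rVpoly (0 : 'rV['F_2]_k) * rVpoly fh.1
        + rVpoly (0 : 'rV['F_2]_(k - d)) * rVpoly fh.2 == 0)%R]| = (2 ^ (s + (s + d)))%N by [].
  have -> : (2 ^ (s + (s + d)) = #|{: 'rV['F_2]_s * 'rV['F_2]_(s + d)}|)%N.
    by rewrite card_prod !card_mx card_Fp // !mul1n expnD.
  by apply: eq_card => fh; rewrite !inE !linear0 !mul0r addr0 eqxx.
under [RHS]eq_bigr do rewrite -dircountE.
rewrite -(sum_wdeg _ _ _ (fun e => 4 ^ (s + d - e))%N); apply: eq_bigr => p p0.
by rewrite /Z card_syzygy -?pair_rV_neq0 // card_Fp // four mulnn.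
Qed.

(** * Closed forms *)

(** The sum of [phi] at the direction degree over all nonzero pairs within the size bounds [k] and
    [k - d]. *)
Definition wsum (d : nat) (phi : nat -> rat) (k : nat) : rat :=
  \sum_(e < k) (dirs d e)%:R * (2 ^+ (k - e) - 1) * phi e.

(** From [2 ^ (k.+1 - e) - 1 = 2 * (2 ^ (k - e) - 1) + 1]; the new index [e = k] contributes weight
    1. *)
Lemma wsumS (d : nat) (phi : nat -> rat) (k : nat) :
  wsum d phi k.+1 = 2 * wsum d phi k + \sum_(e < k.+1) (dirs d e)%:R * phi e.
Proof.
rewrite /wsum !big_ord_recr /= subSnn addrA mulr_sumr -big_split /=; congr (_ + _).
  by apply: eq_bigr => i _; rewrite subSn ?exprS; [ring | exact: ltnW].
ring.
Qed.

Lemma natr_wsum (d k m : nat) :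
  (\sum_(e < k) dirs d e * (2 ^ (k - e) - 1) * 4 ^ (m - e))%N%:R
    = wsum d (fun e => 4 ^+ (m - e)) k.
Proof.
rewrite natr_sum; apply: eq_bigr => e _.
by rewrite !natrM natrB ?expn_gt0 // !natrX.
Qed.

Lemma sum_dirs_partial (d k : nat) :
  \sum_(e < k.+1) (dirs d e)%:R
    = 2 ^+ (k.+1 + (k.+1 - d)) - 2 * 2 ^+ (k + (k - d)) + 1 :> rat.
Proof.
have E n : wsum d (fun=> 1) n = 2 ^+ (n + (n - d)) - 1.
  rewrite -natrX -(sum_dirs d n) natrD addrK natr_sum; apply: eq_bigr => e _.
  by rewrite mulr1 natrM natrB ?expn_gt0 // natrX.
have := wsumS d (fun=> 1) k; under eq_bigr do rewrite mulr1.
rewrite !E; set S := \sum_(e < _) _; lra.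
Qed.

Lemma dirs_first (d : nat) : (dirs d 0)%:R = 2 ^+ (1 + (1 - d)) - 1 :> rat.
Proof.
have := sum_dirs_partial d 0; rewrite big_ord1 => ->.
by rewrite add0n expr0; ring.
Qed.

Lemma dirs_next (d k : nat) :
  (dirs d k.+1)%:R = 2 ^+ (k.+2 + (k.+2 - d)) - 3 * 2 ^+ (k.+1 + (k.+1 - d))
                     + 2 * 2 ^+ (k + (k - d)) :> rat.
Proof.
have := sum_dirs_partial d k.+1; rewrite big_ord_recr /= sum_dirs_partial.
move=> E; move: E; set x := (dirs _ _)%:R; lra.
Qed.

Lemma dirs00 : (dirs 0 0)%:R = 3 :> rat.
Proof. by rewrite dirs_first; apply/eqP. Qed.

Lemma dirs10 : (dirs 1 0)%:R = 1 :> rat.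
Proof. by rewrite dirs_first; apply/eqP. Qed.

Lemma dirs11 : (dirs 1 1)%:R = 4 :> rat.
Proof. by rewrite dirs_next; apply/eqP. Qed.

Lemma dirs0S (e : nat) : (dirs 0 e.+1)%:R = 6 * 4 ^+ e :> rat.
Proof.
rewrite dirs_next !subn0 !addSn !addnS !exprS exprD -expr2 exprAC [2 ^+ 2](_ : _ = 4) //.
by ring.
Qed.

(** The geometric pattern starts only at degree 2: the truncated [k - 1] at [k = 0] makes degrees 0
    and 1 exceptional. *)
Lemma dirs1S (e : nat) : (dirs 1 e.+2)%:R = 12 * 4 ^+ e :> rat.
Proof.
rewrite dirs_next !subSS !subn0 !addSn !addnS !exprS exprD -expr2 exprAC [2 ^+ 2](_ : _ = 4) //.
by ring.
Qed.

Lemma pow4D (m e : nat) : (e <= m)%N -> 4 ^+ e * 4 ^+ (m - e) = 4 ^+ m :> rat.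
Proof. by move=> le_em; rewrite -exprD subnKC. Qed.

(** Up to [m] the growth of [dirs 0 e] balances the decay of the weight, so each [e > 0] adds the
    same [3 / 2 * 4 ^+ m]. *)
Lemma dsum0_small (m k : nat) : (k <= m)%N ->
  \sum_(e < k.+1) (dirs 0 e)%:R * 4 ^+ (m - e) = 4 ^+ m * (3 + 3 / 2 * k%:R) :> rat.
Proof.
elim: k => [_|k IH lt_km]; first by rewrite big_ord1 dirs00 subn0; ring.
rewrite big_ord_recr /= IH ?dirs0S; last exact: ltnW.
by rewrite -(pow4D lt_km) exprS -natr1; field.
Qed.

(** Beyond [m] the truncated exponent is 0, and the added terms form a geometric series of ratio
    4. *)
Lemma dsum0_large (m j : nat) :
  \sum_(e < (m + j).+1) (dirs 0 e)%:R * 4 ^+ (m - e)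
    = 4 ^+ m * (1 + 3 / 2 * m%:R) + 2 * 4 ^+ (m + j) :> rat.
Proof.
elim: j => [|j IH]; first by rewrite addn0 dsum0_small //; ring.
rewrite addnS big_ord_recr /= IH dirs0S (_ : m - (m + j).+1 = 0)%N; last by lia.
by rewrite [4 ^+ (m + j).+1]exprS; ring.
Qed.

Lemma wsum0_small (m k : nat) : (k <= m.+1)%N ->
  wsum 0 (fun e => 4 ^+ (m - e)) k = 4 ^+ m * (9 / 2 * 2 ^+ k - 9 / 2 - 3 / 2 * k%:R).
Proof.
elim: k => [_|k IH lt_km]; first by rewrite /wsum big_ord0; ring.
by rewrite wsumS IH 1?ltnW // dsum0_small // exprS -natr1; field.
Qed.

(** The range starts one below [k = m], where the small closed form still agrees; the final count
    meets this boundary with [m = s.+1] and [k = s]. *)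
Lemma wsum0_large (m k : nat) : (m <= k.+1)%N ->
  wsum 0 (fun e => 4 ^+ (m - e)) k
    = 4 ^+ k - 9 / 2 * 2 ^+ k * 2 ^+ m + 9 / 2 * 2 ^+ k * 4 ^+ m
      - (1 + 3 / 2 * m%:R) * 4 ^+ m.
Proof.
have four n : 4 ^+ n = 2 ^+ n * 2 ^+ n :> rat by rewrite -exprMn.
rewrite leq_eqVlt => /orP[/eqP ->|].
  by rewrite wsum0_small 1?ltnW // !four !exprS -natr1; field.
rewrite ltnS => /subnKC <-; elim: (k - m)%N => [|j IH].
  by rewrite addn0 wsum0_small // !four; field.
by rewrite addnS wsumS IH dsum0_large !four !exprS; field.
Qed.

Lemma dsum1_small (m k : nat) : (k < m)%N ->
  \sum_(e < k.+2) (dirs 1 e)%:R * 4 ^+ (m - e) = 4 ^+ m * (2 + 3 / 4 * k%:R) :> rat.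
Proof.
elim: k => [lt_0m|k IH lt_km].
  rewrite !big_ord_recr big_ord0 /= dirs10 dirs11 subn0.
  by rewrite -(pow4D lt_0m) /=; ring.
rewrite big_ord_recr /= IH ?dirs1S; last exact: ltnW.
by rewrite -(pow4D lt_km) !exprS -natr1; field.
Qed.

Lemma dsum1_large (m j : nat) :
  \sum_(e < (m.+1 + j).+1) (dirs 1 e)%:R * 4 ^+ (m.+1 - e)
    = 4 ^+ m.+1 * (1 + 3 / 4 * m%:R) + 4 ^+ (m.+1 + j) :> rat.
Proof.
elim: j => [|j IH]; first by rewrite addn0 dsum1_small //; ring.
rewrite addnS big_ord_recr /= IH !addSn dirs1S (_ : m.+1 - (m + j).+2 = 0)%N; last by lia.
by rewrite !exprS; ring.
Qed.

Lemma wsum1_small (m k : nat) : (k <= m)%N ->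
  wsum 1 (fun e => 4 ^+ (m - e)) k.+1
    = 4 ^+ m * (15 / 4 * 2 ^+ k - 11 / 4 - 3 / 4 * k%:R).
Proof.
elim: k => [_|k IH lt_km].
  by rewrite /wsum big_ord1 dirs10 !subn0 expr1; field.
by rewrite wsumS IH 1?ltnW // dsum1_small // exprS -natr1; field.
Qed.

Lemma wsum1_large (m k : nat) : (m <= k)%N ->
  wsum 1 (fun e => 4 ^+ (m.+1 - e)) k.+1
    = 2 * 4 ^+ k - 9 * 2 ^+ k * 2 ^+ m + 15 * 2 ^+ k * 4 ^+ m
      - (4 + 3 * m%:R) * 4 ^+ m.
Proof.
have four n : 4 ^+ n = 2 ^+ n * 2 ^+ n :> rat by rewrite -exprMn.
move=> /subnKC <-; elim: (k - m)%N => [|j IH].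
  by rewrite addn0 wsum1_small // !four !exprS; field.
by rewrite addnS wsumS IH -addSn dsum1_large !four !exprS; field.
Qed.

(** * Assembling the count *)

(** The brackets are the normalised moments of [x * x], [x * y] and [y * y], weighted by the
    coefficients of [(x - 2 y) (x - 4 y)], whose value at [x = y = 1] is 3; [4 ^+ (s + k)] counts
    the pairs of forms. *)
Lemma three_Gamma (s k : nat) : (0 < s)%N -> (k.+1 <= s + s)%N ->
  3 * (Gamma s k.+1 k.+1)%:R
    = 4 ^+ (s + k)
      * ((1 + wsum 0 (fun e => 4 ^+ (s - e)) k.+1 / 4 ^+ (s + s))
         - 6 * (1 + wsum 1 (fun e => 4 ^+ (s.+1 - e)) k.+1 / 4 ^+ (s + s.+1))
         + 8 * (1 + wsum 0 (fun e => 4 ^+ (s.+1 - e)) k / 4 ^+ (s.+1 + s.+1))) :> rat.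
Proof.
move=> s0 le_ks; have sk : (s + k.+1 = (s + k).+1)%N by rewrite addnS.
rewrite (Gamma_card s0 _ sk) //.
pose x (ab : 'rV['F_2]_(s + k) * 'rV['F_2]_(s + k)) := #|Kset s k.+1 (cf ab.1) (cf ab.2)|.
pose y (ab : 'rV['F_2]_(s + k) * 'rV['F_2]_(s + k)) := #|Kset s.+1 k (cf ab.1) (cf ab.2)|.
have key ab : 3 * (x ab == 1%N)%:R = ((x ab) * (x ab))%N%:R - 6 * ((x ab) * (y ab))%N%:R
                                     + 8 * ((y ab) * (y ab))%N%:R :> rat.
  rewrite /x /y; have := @card_Kset_step 'F_2 s k (cf ab.1) (cf ab.2) le_ks; rewrite card_Fp //.
  move: #|_| #|_| => X Y [[-> ->] //|[X1 E]].
  by rewrite gtn_eqF // !natrM mulr0n; case: E => ->; rewrite !natrM ?natrX; ring.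
have mom d S K S' K' : (S + K = (s + k).+1)%N -> (d <= K)%N -> K' = (K - d)%N -> S' = (S + d)%N ->
    \sum_(ab : 'rV['F_2]_(s + k) * 'rV['F_2]_(s + k))
       (#|Kset S K (cf ab.1) (cf ab.2)| * #|Kset S' K' (cf ab.1) (cf ab.2)|)%N%:R
    = 4 ^+ (s + k) * (1 + wsum d (fun e => 4 ^+ (S' - e)) K / 4 ^+ (S + S')) :> rat.
  move=> SK dK EK ES; have := second_moment SK dK EK ES.
  move/(congr1 (fun n => n%:R : rat)).
  rewrite [in RHS]natrM natrD natr_wsum natrM !natrX natr_sum -ES => E.
  by apply: (mulIf (_ : 4 ^+ (S + S') != 0)); rewrite ?expf_neq0 // E; field; rewrite expf_neq0.
rewrite !mulrDr mulrN.
transitivity (\sum_ab ((x ab * x ab)%N%:R - 6 * (x ab * y ab)%N%:R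
                       + 8 * (y ab * y ab)%N%:R) : rat).
  rewrite -sum1_card natr_sum mulr_sumr big_mkcond /=; apply: eq_bigr => ab _.
  by rewrite inE -key /x; case: (_ == _); rewrite ?mulr0.
rewrite !big_split /= sumrN -!mulr_sumr.
rewrite (mom 0%N) ?subn0 ?addn0 // (mom 1%N) ?subn1 ?addn1 // (mom 0%N) ?subn0 ?addn0 ?addSn //.
by ring.
Qed.

Theorem theorem2p10 (s i : nat) :
  ((1 <= i <= s)%N ->
     (Gamma s i i)%:R =
       2 ^ (2 * s%:Z + 2 * i%:Z - 2) - 3 * 2 ^ (3 * i%:Z - 4)
       + 2 ^ (2 * i%:Z - 3) :> rat) /\
  ((s + 1 <= i <= 2 * s)%N ->
     (Gamma s i i)%:R =
       2 ^ (2 * s%:Z + 2 * i%:Z - 2) - 3 * 2 ^ (3 * i%:Z - 4)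
       + 2 ^ (4 * i%:Z - 2 * s%:Z - 5) :> rat).
Proof.
case: i => [|k]; first by split; lia.
have four n : 4 ^+ n = 2 ^+ n * 2 ^+ n :> rat by rewrite -exprMn.
have nz n : 2 ^+ n != 0 :> rat by rewrite expf_neq0.
have e1 : 2 ^ (2 * s%:Z + 2 * k.+1%:Z - 2) = (2 ^+ s * 2 ^+ k) ^+ 2 :> rat.
  by rewrite -exprD -exprM exprnP; congr (_ ^ _); lia.
(* At [i = 1] the exponents [3 i - 4] and [2 i - 3] are negative, so these powers are written as
   halves of natural powers. *)
have half (z : int) n : z + 1 = n%:Z -> 2 ^ z = 2 ^+ n / 2 :> rat.
  by move=> E; rewrite [2 ^+ n]exprnP -E expfzDr // expr1z mulfK.
have e2 : 2 ^ (3 * k.+1%:Z - 4) = (2 ^+ k) ^+ 3 / 2 :> rat.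
  by rewrite -exprM; apply: half; lia.
have e3 : 2 ^ (2 * k.+1%:Z - 3) = (2 ^+ k) ^+ 2 / 2 :> rat.
  by rewrite -exprM; apply: half; lia.
have e4 : 2 ^ (4 * k.+1%:Z - 2 * s%:Z - 5) = (2 ^+ k) ^+ 4 / (2 * (2 ^+ s) ^+ 2) :> rat.
  rewrite -!exprM -exprS.
  apply: (mulIf (nz (s * 2).+1)); rewrite mulfVK // !exprnP -expfzDr //.
  by congr (_ ^ _); lia.
have three : 3 != 0 :> rat by [].
split=> /andP[le1 le2]; apply: (mulfI three).
  (* For [i <= s] no weight exponent in the three sums is truncated, so the small closed forms
     apply. *)
  have s0 : (0 < s)%N by lia.
  rewrite three_Gamma //; last by lia.
  rewrite !wsum0_small ?wsum1_small; try lia.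
  rewrite e1 e2 e3 !addnS !addSn !four ![2 ^+ _.+1]exprS !exprD.
  by field; rewrite nz.
have s0 : (0 < s)%N by lia.
rewrite three_Gamma //; last by lia.
rewrite !wsum0_large ?wsum1_large; try lia.
rewrite e1 e2 e4 !addnS !addSn !four ![2 ^+ _.+1]exprS !exprD.
by field; rewrite nz.
Qed.
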